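(* Let $\Gamma$ be an Artin-Tits group of spherical type and let $\mathfrak{D}_{\Gamma}$ be the group of diagram automorphisms of $\Gamma$. Then $$\mathrm{Aut}(\Gamma,\leq)=L_{\Gamma}\rtimes\mathfrak{D}_{\Gamma}\leq \mathrm{Hol}(\Gamma)$$ (an internal semidirect product of subgroups of the symmetric group on the set $\Gamma$, with $L_\Gamma$ normal).
   Context: A Coxeter matrix on a set $S$ is a map $m:S\times S\to\mathbb{Z}_{\geq 1}$, $(i,j)\mapsto m_{ij}$, with $m_{ij}=m_{ji}$ and $m_{ij}=1$ iff $i=j$. For $k\geq 1$, $r_k(x,y)=xyxy\cdots$ denotes the alternating product with $k$ factors starting with $x$. The Artin-Tits monoid $\Gamma^+$ (resp. group $\Gamma$) of $m$ is the monoid (resp. group) with generators $\sigma_i$ ($i\in S$) and relations $r_{m_{ij}}(\sigma_i,\sigma_j)=r_{m_{ij}}(\sigma_j,\sigma_i)$ ($i,j\in S$). It is spherical (of spherical type) if the Coxeter group, obtained from $\Gamma$ by adding the relations $\sigma_i^2=1$, is finite. For spherical $\Gamma$, by Brieskorn–Saito the canonical map $\Gamma^+\to\Gamma$ is injective and its image (the submonoid generated by the $\sigma_i$) is the positive cone of a left-invariant lattice order $\leq$ on $\Gamma$: $g\leq h$ iff $g^{-1}h\in\Gamma^+$. $\Gamma$ always carries this order. For a permutation $\phi$ of $S$ with $m_{\phi(i)\phi(j)}=m_{ij}$ for all $i,j$, let $\delta_\phi$ be the automorphism of $\Gamma$ with $\delta_\phi(\sigma_i)=\sigma_{\phi(i)}$;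 such automorphisms are called diagram automorphisms, and $\mathfrak{D}_\Gamma$ is the group they form. $\mathrm{Aut}(\Gamma,\leq)$ is the group of all order-automorphisms of the poset $(\Gamma,\leq)$ (not necessarily group automorphisms). $L_\Gamma=\{l_g: g\in\Gamma\}$ with $l_g(x)=gx$ is the group of left translations. The holomorph $\mathrm{Hol}(\Gamma)$ is the normalizer of $L_\Gamma$ in the symmetric group on the set $\Gamma$. *)

(* Defs.v *)
From HB Require Import structures.
From mathcomp Require Import all_boot.
From mathcomp Require Import boolp classical_sets functions cardinality.

Set Implicit Arguments.
Unset Strict Implicit.
Unset Printing Implicit Defensive.

Local Open Scope classical_set_scope.
Local Open Scope quotient_scope.
Local Open Scope group_scope.

(* The letter (x, false) stands for x and (x, true) for x^-1. *)
Definition group_word (X : Type) := seq (X * bool).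

Definition word_inv (X : Type) (w : group_word X) : group_word X :=
  rev [seq (a.1, ~~ a.2) | a <- w].

Inductive word_eqv (X : Type) (rels : group_word X -> group_word X -> Prop) :
    group_word X -> group_word X -> Prop :=
| Word_refl u : word_eqv rels u u
| Word_sym u v : word_eqv rels u v -> word_eqv rels v u
| Word_trans u v w :
    word_eqv rels u v -> word_eqv rels v w -> word_eqv rels u w
| Word_cat u u' v v' :
    word_eqv rels u u' -> word_eqv rels v v' -> word_eqv rels (u ++ v) (u' ++ v')
| Word_cancel x b : word_eqv rels [:: (x, b); (x, ~~ b)] [::]
| Word_rel u v : rels u v -> word_eqv rels u v.

Section PresentedGroup.
Variables (X : choiceType) (rels : group_word X -> group_word X -> Prop).

Definition word_eqvb : rel (group_word X) := fun u v => `[< word_eqv rels u v >].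

Lemma word_eqvb_refl : reflexive word_eqvb.
Proof. by move=> u; apply/asboolP/Word_refl. Qed.

Lemma word_eqvb_sym : symmetric word_eqvb.
Proof. by move=> u v; apply/asboolP/asboolP; apply: Word_sym. Qed.

Lemma word_eqvb_trans : transitive word_eqvb.
Proof.
by move=> v u w /asboolP uv /asboolP vw; apply/asboolP; apply: Word_trans vw.
Qed.

Canonical word_equiv :=
  EquivRel word_eqvb word_eqvb_refl word_eqvb_sym word_eqvb_trans.

Definition presented_group := {eq_quot word_equiv}.

HB.instance Definition _ := Choice.on presented_group.
HB.instance Definition _ := EqQuotient.on presented_group.

Definition class_of (w : group_word X) : presented_group := \pi w.

Lemma class_ofP u v : class_of u = class_of v <-> word_eqv rels u v.
Proof.
split=> [/eqmodP/asboolP //|uv].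
by apply/eqmodP/asboolP.
Qed.

Lemma repr_class_of u : word_eqv rels (repr (class_of u)) u.
Proof. by apply/class_ofP; rewrite /class_of reprK. Qed.

Lemma word_invK : involutive (@word_inv X).
Proof.
move=> w; rewrite /word_inv map_rev revK -map_comp map_id_in // => -[x b] _ /=.
by rewrite negbK.
Qed.

Lemma word_eqv_mulVw w : word_eqv rels (word_inv w ++ w) [::].
Proof.
elim: w => [|[x b] w IHw]; first exact: Word_refl.
rewrite /word_inv /= rev_cons -cats1 -catA /=.
apply: Word_trans IHw; apply: Word_cat (Word_refl _ _) _.
apply: (@Word_cat _ _ [:: (x, ~~ b); (x, b)] [::] w w _ (Word_refl _ _)).
by have := Word_cancel rels x (~~ b); rewrite negbK.
Qed.

Lemma word_eqv_mulwV w : word_eqv rels (w ++ word_inv w) [::].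
Proof. by have := word_eqv_mulVw (word_inv w); rewrite word_invK. Qed.

Lemma word_eqv_inv u v :
  word_eqv rels u v -> word_eqv rels (word_inv u) (word_inv v).
Proof.
move=> uv; apply: (@Word_trans _ _ _ (word_inv u ++ (v ++ word_inv v))).
  rewrite -[X in word_eqv _ X]cats0.
  by apply: Word_cat (Word_refl _ _) (Word_sym (word_eqv_mulwV v)).
rewrite catA -[X in word_eqv _ _ X]cat0s; apply: Word_cat (Word_refl _ _).
apply: Word_trans (word_eqv_mulVw u).
exact: Word_cat (Word_refl _ _) (Word_sym uv).
Qed.

Definition pres_one : presented_group := class_of [::].
Definition pres_mul (g h : presented_group) : presented_group :=
  class_of (repr g ++ repr h).
Definition pres_inv (g : presented_group) : presented_group :=
  class_of (word_inv (repr g)).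

Lemma class_of_cat u v : pres_mul (class_of u) (class_of v) = class_of (u ++ v).
Proof. by apply/class_ofP/Word_cat; apply: repr_class_of. Qed.

Lemma class_of_inv u : pres_inv (class_of u) = class_of (word_inv u).
Proof. exact/class_ofP/word_eqv_inv/repr_class_of. Qed.

Lemma class_of_surj (g : presented_group) : exists w, g = class_of w.
Proof. by exists (repr g); rewrite /class_of reprK. Qed.

Lemma pres_mulA : associative pres_mul.
Proof.
move=> g h k; have [u ->] := class_of_surj g; have [v ->] := class_of_surj h.
by have [w ->] := class_of_surj k; rewrite !class_of_cat catA.
Qed.

Lemma pres_mul1g : left_id pres_one pres_mul.
Proof. by move=> g; have [u ->] := class_of_surj g; rewrite class_of_cat. Qed.

Lemma pres_mulg1 : right_id pres_one pres_mul.
Proof.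
by move=> g; have [u ->] := class_of_surj g; rewrite class_of_cat cats0.
Qed.

Lemma pres_mulVg : left_inverse pres_one pres_inv pres_mul.
Proof.
move=> g; have [u ->] := class_of_surj g.
rewrite class_of_inv class_of_cat; exact/class_ofP/word_eqv_mulVw.
Qed.

Lemma pres_mulgV : right_inverse pres_one pres_inv pres_mul.
Proof.
move=> g; have [u ->] := class_of_surj g.
rewrite class_of_inv class_of_cat; exact/class_ofP/word_eqv_mulwV.
Qed.

HB.instance Definition _ := isGroup.Build presented_group
  pres_mulA pres_mul1g pres_mulg1 pres_mulVg pres_mulgV.

Definition pres_gen (x : X) : presented_group := class_of [:: (x, false)].

End PresentedGroup.

Record coxeter_matrix (S : Type) := CoxeterMatrix {
  cox_entry :> S -> S -> nat;
  cox_gt0 : forall i j, (0 < cox_entry i j)%N;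
  cox_sym : forall i j, cox_entry i j = cox_entry j i;
  cox_eq1 : forall i j, cox_entry i j = 1%N <-> i = j
}.

(* The alternating word x y x y ... with k letters. *)
Fixpoint alt_word (X : Type) (k : nat) (x y : X) : group_word X :=
  if k is k'.+1 then (x, false) :: alt_word k' y x else [::].

Section ArtinTits.
Variables (S : choiceType) (m : coxeter_matrix S).

Inductive artin_rel : group_word S -> group_word S -> Prop :=
| Artin_braid i j : artin_rel (alt_word (m i j) i j) (alt_word (m i j) j i).

Inductive coxeter_rel : group_word S -> group_word S -> Prop :=
| Coxeter_artin u v : artin_rel u v -> coxeter_rel u v
| Coxeter_square i : coxeter_rel [:: (i, false); (i, false)] [::].

Definition artin_group := presented_group artin_rel.
Definition coxeter_group := presented_group coxeter_rel.

HB.instance Definition _ := Group.on artin_group.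
HB.instance Definition _ := Group.on coxeter_group.

Definition artin_gen (i : S) : artin_group := pres_gen artin_rel i.

Definition spherical : Prop := finite_set [set: coxeter_group].

(* The image in the group of the Artin-Tits monoid, that is, the submonoid
   generated by the artin_gen i. *)
Definition artin_positive : set artin_group :=
  [set g | exists w : seq S, g = \prod_(i <- w) artin_gen i].

Definition artin_le (g h : artin_group) : Prop := artin_positive (g^-1 * h).

End ArtinTits.

Arguments artin_positive {S} m _.

Record sym (T : Type) := Sym {
  sym_fun :> T -> T;
  sym_bij : bijective sym_fun
}.

Section SymmetricGroup.
Variable T : Type.

HB.instance Definition _ := gen_eqMixin (sym T).
HB.instance Definition _ := gen_choiceMixin (sym T).

Lemma sym_eq (f g : sym T) : f =1 g -> f = g.
Proof.
case: f g => [f bf] [g bg] /= /funext fg; move: bf bg; rewrite fg => bf bg.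
by congr Sym; apply: Prop_irrelevance.
Qed.

Lemma sym_inv_exists (f : sym T) : exists g : sym T, cancel f g /\ cancel g f.
Proof.
by have [g fK gK] := sym_bij f; exists (Sym (Bijective gK fK)); split.
Qed.

Definition sym_one : sym T := Sym (Bijective (frefl id) (frefl id)).
Definition sym_mul (f g : sym T) : sym T :=
  Sym (bij_comp (sym_bij f) (sym_bij g)).
Definition sym_inv (f : sym T) : sym T := sval (cid (sym_inv_exists f)).

Lemma sym_invP (f : sym T) : cancel f (sym_inv f) /\ cancel (sym_inv f) f.
Proof. exact: svalP (cid (sym_inv_exists f)). Qed.

Lemma sym_mulA : associative sym_mul.
Proof. by move=> f g h; apply: sym_eq. Qed.

Lemma sym_mul1g : left_id sym_one sym_mul.
Proof. by move=> f; apply: sym_eq. Qed.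

Lemma sym_mulg1 : right_id sym_one sym_mul.
Proof. by move=> f; apply: sym_eq. Qed.

Lemma sym_mulVg : left_inverse sym_one sym_inv sym_mul.
Proof. by move=> f; apply: sym_eq => x /=; case: (sym_invP f). Qed.

Lemma sym_mulgV : right_inverse sym_one sym_inv sym_mul.
Proof. by move=> f; apply: sym_eq => x /=; case: (sym_invP f). Qed.

HB.instance Definition _ := isGroup.Build (sym T)
  sym_mulA sym_mul1g sym_mulg1 sym_mulVg sym_mulgV.

End SymmetricGroup.

Section Subgroups.
Variable G : groupType.
Implicit Types A B N H : set G.

Definition is_subgroup A : Prop :=
  [/\ A 1, (forall x y, A x -> A y -> A (x * y)) & forall x, A x -> A x^-1].

Definition normaliser A : set G := [set g | [set g * x * g^-1 | x in A] = A].

Definition internal_sdprod A N H : Prop :=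
  [/\ is_subgroup A,
      is_subgroup N /\ is_subgroup H,
      N `<=` A /\ A `<=` normaliser N,
      N `&` H = [set 1] &
      [set x * y | x in N & y in H] = A].

End Subgroups.

Definition left_translations (G : groupType) : set (sym G) :=
  [set f | exists g : G, forall x, f x = g * x].

Arguments left_translations G _ : clear implicits.

Definition holomorph (G : groupType) : set (sym G) :=
  normaliser (left_translations G).

Arguments holomorph G _ : clear implicits.

Section ArtinAutomorphisms.
Variables (S : choiceType) (m : coxeter_matrix S).

Definition order_automorphisms : set (sym (artin_group m)) :=
  [set f | forall x y, artin_le x y <-> artin_le (f x) (f y)].

Definition diagram_automorphisms : set (sym (artin_group m)) :=
  [set f | {morph f : x y / x * y} /\
    exists phi : sym S,
      (forall i j, m (phi i) (phi j) = m i j) /\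
      (forall i, f (artin_gen m i) = artin_gen m (phi i))].

End ArtinAutomorphisms.

Arguments order_automorphisms {S} m _.
Arguments diagram_automorphisms {S} m _.

(* Main.v *)
From Stdlib Require Import Reals Lra Lia ZArith.
Require Import Defs.
From mathcomp Require Import all_boot.
From mathcomp Require Import boolp classical_sets functions cardinality.

Set Implicit Arguments.
Unset Strict Implicit.
Unset Printing Implicit Defensive.

Local Open Scope group_scope.

(** Write [a i] for the generators of the Artin-Tits group and let [f] be an
automorphism of the order.  Positive words have a length that is constant on
each element of the group, so [y] covers [x] exactly when [y = x * a i], and
[f] carries covers to covers: [f (g * a i) = f g * a (phi g i)] for a
permutation [phi g] of the index set.  The whole theorem is the claim that
[phi g] depends on [g] only trivially and preserves the Coxeter matrix: an
[f] that fixes 1 is then the homomorphism induced by a diagram automorphism,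
and any [f] becomes such after composition with a left translation
([order_automorphism_decomp]).

The claim is a statement about the two chains
[g < g * a i < g * a i * a j < ...] and [g < g * a j < g * a j * a i < ...]
with [m i j] steps, which meet again at the braid relation.  Their images are
two chains of length [m i j] that start with the distinct letters [phi g i] and
[phi g j] and also meet.  Lemma [shortest_relation] says that two positive words
with distinct first letters [i], [j] and the same value in the group have
length at least [m i j], and that in length [m i j] they are the two sides of
the braid relation.  Used for [f] and for its inverse, it shows that [phi g]
preserves [m] and that the image of an alternating chain is alternating.  The
second letter of that chain reads [phi (g * a i) j = phi g j] for every [j]
other than [i]; two permutations that agree off one point agree, so
[phi (g * a i) = phi g] and [phi] is constant ([follows_const]).

For [shortest_relation], equality in the group (and not only in the monoid) has
to be exploited, which is done with a representation by invertible operators.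
The Hecke algebra, with quadratic relation [T_i ^ 2 = T_i + 1], acts on the
integer functions on the Coxeter group [W]; the Artin-Tits group acts through
it, and a positive word has non-negative coefficients in the standard basis, so
its support in [W] is an invariant of the group element.  If the word starts
with [i], that support is stable under [w |-> s_i * w] whenever this goes up in
[W].  For two equal words starting with [i] and [j] the support thus contains
an element that is on top of its coset of the dihedral subgroup generated by
[s_i] and [s_j], and such an element has all [m i j] dihedral reflections among
its inversions.  Elements of the support are products of subwords, so the words
have at least [m i j] letters, and in case of equality they cross exactly the
dihedral reflections, which forces them to alternate.

Inversions are handled through the reflection cocycle: [inversion w t] counts
modulo 2 how often a word for [w] crosses [t], and is well defined because [W]
acts on [W * bool] accordingly.  That the [m i j] dihedral reflections are
pairwise distinct, i.e. that [s_i * s_j] has order exactly [m i j], is read off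
the Tits representation over the reals. *)

(** * Words, presented groups and permutations *)

Definition word_eval (X : Type) (G : groupType) (e : X -> G)
    (w : group_word X) : G :=
  \prod_(a <- w) (if a.2 then (e a.1)^-1 else e a.1).

Definition pos_word (X : Type) (p : seq X) : group_word X :=
  [seq (x, false) | x <- p].

Lemma word_eval_pos X (G : groupType) (e : X -> G) p :
  word_eval e (pos_word p) = \prod_(x <- p) e x.
Proof. by rewrite /word_eval big_map. Qed.

Lemma word_eval_sound X (G : groupType) (e : X -> G) rels u v :
    (forall x y, rels x y -> word_eval e x = word_eval e y) ->
  word_eqv rels u v -> word_eval e u = word_eval e v.
Proof.
move=> Hrels; elim=> {u v} [//|u v _ -> //|u v w _ -> _ -> //|||//].
  move=> u u' v v' _ eu _ ev.
  by rewrite /word_eval !big_cat -!/(word_eval _ _) eu ev.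
by move=> x [] /=; rewrite /word_eval !big_cons big_nil /= mulg1 ?mulgV ?mulVg.
Qed.

Section PresentedGroupTheory.
Variables (X : choiceType) (rels : group_word X -> group_word X -> Prop).
Local Notation P := (presented_group rels).
Local Notation gen := (pres_gen rels).

Lemma class_of_eval w : class_of rels w = word_eval gen w.
Proof.
elim: w => [|[x b] w IHw]; first by rewrite /word_eval big_nil.
have -> : class_of rels ((x, b) :: w) =
    class_of rels [:: (x, b)] * class_of rels w.
  by rewrite -[LHS]/(class_of rels ([:: (x, b)] ++ w)) -class_of_cat.
rewrite IHw /word_eval big_cons /=; congr (_ * _); case: b => //.
by rewrite -[LHS]/(class_of rels (word_inv [:: (x, false)])) -class_of_inv.
Qed.

Lemma pres_eval_surj (g : P) : exists w, g = word_eval gen w.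
Proof. by have [w ->] := class_of_surj g; exists w; apply: class_of_eval. Qed.

Lemma pres_eval_eq u v :
  word_eval gen u = word_eval gen v <-> word_eqv rels u v.
Proof. by rewrite -!class_of_eval; apply: class_ofP. Qed.

Lemma pres_ind (Q : P -> Prop) :
    Q 1 -> (forall g x, Q g -> Q (g * gen x)) ->
    (forall g x, Q g -> Q (g * (gen x)^-1)) ->
  forall g, Q g.
Proof.
move=> Q1 QM QV g; have [w ->] := pres_eval_surj g.
elim/last_ind: w => [|w [x b] IHw]; first by rewrite /word_eval big_nil.
by rewrite /word_eval -cats1 big_cat big_seq1 /=; case: b; [apply: QV|apply: QM].
Qed.

Section Lift.
Variables (G : groupType) (e : X -> G).
Hypothesis Hrels : forall u v, rels u v -> word_eval e u = word_eval e v.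

Definition pres_lift (g : P) : G := word_eval e (repr g).

Lemma pres_lift_class w : pres_lift (class_of rels w) = word_eval e w.
Proof. exact/(word_eval_sound Hrels)/repr_class_of. Qed.

Lemma pres_lift_gen x : pres_lift (gen x) = e x.
Proof. by rewrite pres_lift_class /word_eval big_seq1. Qed.

Lemma pres_liftM : {morph pres_lift : g h / g * h}.
Proof.
move=> g h; have [u ->] := class_of_surj g; have [v ->] := class_of_surj h.
have -> : class_of rels u * class_of rels v = class_of rels (u ++ v).
  exact: class_of_cat.
by rewrite !pres_lift_class /word_eval big_cat.
Qed.

Lemma pres_lift1 : pres_lift 1 = 1.
Proof. by apply: (mulgI (pres_lift 1)); rewrite -pres_liftM !mulg1. Qed.

Lemma pres_lift_prod p :
  pres_lift (\prod_(x <- p) gen x) = \prod_(x <- p) e x.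
Proof.
elim: p => [|x p IHp]; first by rewrite !big_nil pres_lift1.
by rewrite !big_cons pres_liftM IHp pres_lift_gen.
Qed.

End Lift.
End PresentedGroupTheory.

Section SymTheory.
Variable T : Type.
Implicit Types f g : sym T.

Lemma symM f g x : (f * g) x = f (g x). Proof. by []. Qed.
Lemma sym1 x : (1 : sym T) x = x. Proof. by []. Qed.
Lemma symK f : cancel f (f^-1)%g. Proof. by case: (sym_invP f). Qed.
Lemma symVK f : cancel (f^-1)%g f. Proof. by case: (sym_invP f). Qed.
Lemma sym_inj f : injective f. Proof. exact: can_inj (symK f). Qed.

End SymTheory.

(** * Alternating words *)

Fixpoint alt_seq (X : Type) k (i j : X) : seq X :=
  if k is k'.+1 then i :: alt_seq k' j i else [::].

Fixpoint alt_prod (G : groupType) k (a b : G) : G :=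
  if k is k'.+1 then a * alt_prod k' b a else 1.

Lemma alt_word_pos X k (i j : X) : alt_word k i j = pos_word (alt_seq k i j).
Proof. by elim: k i j => //= k IHk i j; rewrite IHk. Qed.

Lemma size_alt_seq X k (i j : X) : size (alt_seq k i j) = k.
Proof. by elim: k i j => //= k IHk i j; rewrite IHk. Qed.

Lemma mem_alt_seq (X : eqType) k (i j : X) :
  {subset alt_seq k i j <= [:: i; j]}.
Proof.
elim: k i j => //= k IHk i j x; rewrite inE => /orP[/eqP->|/IHk].
  exact: mem_head.
by rewrite !inE orbC.
Qed.

Lemma prod_alt_seq X (G : groupType) (e : X -> G) k i j :
  \prod_(x <- alt_seq k i j) e x = alt_prod k (e i) (e j).
Proof.
by elim: k i j => [|k IHk] i j; rewrite /= ?big_nil // big_cons IHk.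
Qed.

Lemma word_eval_alt X (G : groupType) (e : X -> G) k i j :
  word_eval e (alt_word k i j) = alt_prod k (e i) (e j).
Proof. by rewrite alt_word_pos word_eval_pos prod_alt_seq. Qed.

Lemma expgMC (G : groupType) (a b : G) h :
  a * (b * a) ^+ h * b = (a * b) ^+ h.+1.
Proof.
elim: h => [|h IHh]; first by rewrite mulg1.
by rewrite expgSr [RHS]expgSr -IHh !mulgA.
Qed.

Section Involutions.
Variables (G : groupType) (a b : G).
Hypotheses (aa : a * a = 1) (bb : b * b = 1).

(** Both alternating products differ by a power of the rotation [a * b], because
the letters of [alt_prod k b a] cancel one by one against it. *)
Lemma alt_prod_rotation k : (a * b) ^+ k * alt_prod k b a = alt_prod k a b.
Proof.
elim: k a b aa bb => [|k IHk] x y xx yy /=; first by rewrite mulg1.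
rewrite -expgMC !mulgA -(mulgA _ y y) yy mulg1 -mulgA.
by rewrite IHk.
Qed.

Lemma alt_prod_braid k : alt_prod k a b = alt_prod k b a <-> (a * b) ^+ k = 1.
Proof.
rewrite -alt_prod_rotation; split=> [E|->]; last by rewrite mul1g.
by apply: (mulIg (alt_prod k b a)); rewrite E mul1g.
Qed.

End Involutions.
(** * The Tits representation *)

Section Tits.
Variables (S : choiceType) (m : coxeter_matrix S).
Local Open Scope R_scope.

(** Twice the cosine form of the Coxeter matrix; the diagonal value 2 makes
[tits_fun i] an involution. *)
Definition tits_coef (i l : S) : R :=
  if l == i then 2 else - (2 * cos (PI / INR (m l i))).

(** The contragredient reflection representation: a function on [S] is a linear
form given by its values on the simple roots. *)
Definition tits_fun (i : S) (F : S -> R) : S -> R :=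
  fun l => F l - tits_coef i l * F i.

Lemma tits_funK i : involutive (tits_fun i).
Proof.
move=> F; apply/funext => l; rewrite /tits_fun /tits_coef eqxx; ring.
Qed.

Definition tits_refl (i : S) : sym (S -> R) :=
  Sym (Bijective (tits_funK i) (tits_funK i)).

Lemma tits_reflK i : (tits_refl i * tits_refl i = 1)%g.
Proof. by apply: sym_eq => F /=; rewrite tits_funK. Qed.

Section Rotation.
Variables (i j : S).
Hypothesis ij : i <> j.

Let th : R := PI / INR (m i j).
Let c : R := 2 * cos th.
(* Chebyshev polynomials of the second kind in [c], shifted by one index. *)
Let u (n : nat) : R := sin (INR n * th) / sin th.

Lemma cox_entry_gt1 : (1 < m i j)%N.
Proof.
rewrite ltn_neqAle cox_gt0 andbT eq_sym; apply/eqP => /esym E.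
by apply: ij; apply/(cox_eq1 m i j).
Qed.

Let mR_gt1 : 1 < INR (m i j).
Proof. by rewrite -INR_1; apply/lt_INR/ltP; exact: cox_entry_gt1. Qed.

Let sin_multiple_gt0 k : (0 < k < m i j)%N -> 0 < sin (INR k * th).
Proof.
case/andP=> /ltP /lt_INR /= k0 /ltP /lt_INR km; have pi0 := PI_RGT_0.
have th0 : 0 < th by apply: Rdiv_lt_0_compat => //; lra.
have Eth : INR (m i j) * th = PI by rewrite /th; field; lra.
apply: sin_gt_0; first exact: Rmult_lt_0_compat.
by rewrite -Eth; apply: Rmult_lt_compat_r.
Qed.

Let sin_th_gt0 : 0 < sin th.
Proof.
have -> : th = INR 1 * th by rewrite INR_1; ring.
by apply: sin_multiple_gt0; rewrite cox_entry_gt1.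
Qed.

Let u0 : u 0 = 0.
Proof. by rewrite /u /= Rmult_0_l sin_0 /Rdiv Rmult_0_l. Qed.

Let u1 : u 1 = 1.
Proof. by rewrite /u /= Rmult_1_l; field; lra. Qed.

Let uS n : u n.+2 = c * u n.+1 - u n.
Proof.
rewrite /u /c !S_INR.
have -> : (INR n + 1 + 1) * th = INR n * th + 2 * th by ring.
have -> : (INR n + 1) * th = INR n * th + th by ring.
rewrite !sin_plus sin_2a cos_2a.
have := sin2_cos2 th; rewrite /Rsqr => E.
have -> : cos th * cos th - sin th * sin th = 2 * (cos th * cos th) - 1 by lra.
field; lra.
Qed.

Let u_cassini n : u n * u n + u n.+1 * u n.+1 - c * u n * u n.+1 = 1.
Proof.
elim: n => [|n IHn]; first by rewrite u0 u1; ring.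
by rewrite uS -[RHS]IHn; ring.
Qed.

Let u_order : u (m i j) = 0.
Proof.
rewrite /u; have -> : INR (m i j) * th = PI by rewrite /th; field; lra.
by rewrite sin_PI /Rdiv Rmult_0_l.
Qed.

Let u_gt0 k : (0 < k < m i j)%N -> 0 < u k.
Proof. by move=> /sin_multiple_gt0 H; apply: Rdiv_lt_0_compat. Qed.

Let coef_ij : tits_coef i j = - c /\ tits_coef j i = - c.
Proof.
rewrite /tits_coef /c /th (cox_sym m j i).
by case: eqP => [/esym//|_]; case: eqP.
Qed.

(** The powers of the rotation in closed form.  Every correction term is a
multiple of [u n], so the rotation has order dividing [m i j] on the whole
space as soon as [u (m i j) = 0], without splitting off the plane spanned by the
two roots. *)
Lemma tits_rotation n F l :
  ((tits_refl j * tits_refl i) ^+ n)%g F l =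
    F l
    - tits_coef i l * (F i * (u n * u n) + F j * (u n * (c * u n - u n.+1)))
    - tits_coef j l * (F i * (u n.+1 * u n) + F j * (u n * u n)).
Proof.
have [cij cji] := coef_ij.
have cii x : tits_coef x x = 2 by rewrite /tits_coef eqxx.
elim: n l => [|n IHn] l; first by rewrite expg0 sym1 u0; ring.
rewrite expgS !symM /= /tits_fun !IHn uS !cii cij cji.
have := u_cassini n; set p := u n; set q := u n.+1 => E.
have -> : q * q = 1 - p * p + c * p * q by lra.
set b := tits_coef i l; set d := tits_coef j l.
have -> : (c * q - p) * q = c * (1 - p * p + c * p * q) - p * q by rewrite -E; ring.
ring.
Qed.

Lemma tits_rotation_order : ((tits_refl j * tits_refl i) ^+ m i j = 1)%g.
Proof.
by apply: sym_eq => F; apply/funext => l; rewrite tits_rotation u_order /=; ring.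
Qed.

(** If a power fixed the coordinate form at [j], the closed form together with
[u_cassini] would give [c ^ 2 = 4], whereas [c] is twice the cosine of an angle
strictly between 0 and pi. *)
Lemma tits_rotation_faithful k :
  (0 < k < m i j)%N -> ((tits_refl j * tits_refl i) ^+ k <> 1)%g.
Proof.
move=> km E; have [cij cji] := coef_ij; have p0 := u_gt0 km.
pose F l : R := if l == j then 1 else 0.
have Fi : F i = 0 by rewrite /F; case: eqP.
have Fj : F j = 1 by rewrite /F eqxx.
have Ei := tits_rotation k F i; have Ej := tits_rotation k F j.
move: Ei Ej; rewrite E !sym1 Fi Fj cij cji /tits_coef !eqxx.
have C := u_cassini k; move: p0 C; set p := u k; set q := u k.+1 => p0 C Ei Ej.
have Eq : 2 * q = c * p by apply: (Rmult_eq_reg_l p); lra.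
have Ep : c * (c * p - q) = 2 * p by apply: (Rmult_eq_reg_l p); lra.
have s2 := sin2_cos2 th; move: sin_th_gt0 s2; rewrite /Rsqr => s0 s2.
have H : c * c = 4.
  apply: (Rmult_eq_reg_r p); last lra.
  have -> : c * c * p = 2 * (c * (c * p - q)) - c * (c * p - 2 * q) by ring.
  by rewrite Ep Eq; ring.
have : 0 < sin th * sin th by apply: Rmult_lt_0_compat.
by rewrite /c in H; lra.
Qed.

End Rotation.

Lemma tits_alt i j :
  (alt_prod (m i j) (tits_refl i) (tits_refl j) =
   alt_prod (m i j) (tits_refl j) (tits_refl i))%g.
Proof.
have [->//|/eqP ij] := eqVneq i j.
apply/alt_prod_braid; rewrite ?tits_reflK // cox_sym.
by apply: tits_rotation_order => /esym.
Qed.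

(** The linear form dual to the simple root [l]; it is moved by the reflection
in [l] only, which separates each generator from the subgroup generated by the
others. *)
Definition tits_coord (l x : S) : R := if x == l then 1 else 0.

Lemma tits_refl_coord i l : i != l -> tits_refl i (tits_coord l) = tits_coord l.
Proof.
move=> /negPf il; apply/funext => x.
by rewrite /= /tits_fun {2}/tits_coord il; ring.
Qed.

Lemma tits_refl_coord_neq l : tits_refl l (tits_coord l) <> tits_coord l.
Proof.
move/(congr1 (@^~ l)).
by rewrite /= /tits_fun /tits_coef /tits_coord eqxx; lra.
Qed.

End Tits.

(** * The Coxeter group *)

Section CoxeterGroup.
Variables (S : choiceType) (m : coxeter_matrix S).

Local Notation W := (coxeter_group m).
Definition cox_gen (i : S) : W := pres_gen (coxeter_rel m) i.
Local Notation s := cox_gen.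
Local Notation cprod p := (\prod_(i <- p) s i).

(** Universal property of the Coxeter group, in the form in which relations are
checked on involutions. *)
Lemma coxeter_sound (G : groupType) (e : S -> G) :
    (forall i, e i * e i = 1) ->
    (forall i j, alt_prod (m i j) (e i) (e j) = alt_prod (m i j) (e j) (e i)) ->
  forall u v, coxeter_rel m u v -> word_eval e u = word_eval e v.
Proof.
move=> e2 ebraid u v [_ _ [i j]|i]; first by rewrite !word_eval_alt ebraid.
by rewrite /word_eval !big_cons big_nil /= mulg1 e2.
Qed.

Lemma cox_genK i : s i * s i = 1.
Proof.
have /(pres_eval_eq (coxeter_rel m)) := Word_rel (Coxeter_square m i).
by rewrite /word_eval !big_cons !big_nil mulg1.
Qed.

Lemma cox_genV i : (s i)^-1 = s i.
Proof. by apply: mulg1_eq; apply: cox_genK. Qed.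

Lemma cox_genKl i (w : W) : s i * (s i * w) = w.
Proof. by rewrite mulgA cox_genK mul1g. Qed.

Lemma cox_genKr i (w : W) : w * s i * s i = w.
Proof. by rewrite -mulgA cox_genK mulg1. Qed.

Lemma cox_braid i j :
  alt_prod (m i j) (s i) (s j) = alt_prod (m i j) (s j) (s i).
Proof.
rewrite -!word_eval_alt.
by apply/pres_eval_eq/Word_rel/Coxeter_artin.
Qed.

Lemma cox_prod_surj (w : W) : exists p, w = cprod p.
Proof.
elim/pres_ind: w => [|w i [p ->]|w i [p ->]].
- by exists [::]; rewrite big_nil.
- by exists (rcons p i); rewrite -cats1 big_cat big_seq1.
- by exists (rcons p i); rewrite -cats1 big_cat big_seq1 -/(s i) cox_genV.
Qed.

Lemma cox_rotation_order i j : (s i * s j) ^+ m i j = 1.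
Proof. by apply/alt_prod_braid; rewrite ?cox_genK //; apply: cox_braid. Qed.

Local Notation tits := (pres_lift (rels := coxeter_rel m) (@tits_refl S m)).

Let titsP := coxeter_sound (@tits_reflK S m) (tits_alt m).

Lemma cox_rotation_faithful i j k :
  i <> j -> (k < m i j)%N -> (s i * s j) ^+ k = 1 -> k = 0%N.
Proof.
move=> ij km E; apply/eqP; rewrite -leqn0 leqNgt; apply/negP => k0.
have [] := @tits_rotation_faithful S m j i _ k; first by move/esym.
  by rewrite k0 cox_sym.
rewrite -(pres_lift1 titsP) -E; elim: k {km E k0} => [|k IHk].
  by rewrite !expg0 (pres_lift1 titsP).
by rewrite !expgS !(pres_liftM titsP) -IHk !(pres_lift_gen titsP).
Qed.

Lemma cox_gen_notin l p : l \notin p -> cprod p <> s l.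
Proof.
move=> lp /(congr1 tits); rewrite (pres_lift_gen titsP) (pres_lift_prod titsP).
have Fp : (\prod_(i <- p) tits_refl m i) (tits_coord l) = tits_coord l.
  elim: p lp => [|i p IHp]; first by rewrite big_nil.
  rewrite inE negb_or big_cons symM eq_sym => /andP[li lp].
  by rewrite IHp // tits_refl_coord.
move/(congr1 (fun f : sym (S -> R) => f (tits_coord l)))/esym.
by rewrite Fp => /tits_refl_coord_neq.
Qed.

End CoxeterGroup.
(** * The reflection cocycle *)

Section ReflectionCocycle.
Variables (S : choiceType) (m : coxeter_matrix S).

Local Notation W := (coxeter_group m).
Local Notation s := (cox_gen m).
Local Notation cprod p := (\prod_(i <- p) s i).

(** The reflections (walls) crossed by the gallery that reads [p] from the
identity chamber: [s_1], [s_1 s_2 s_1], [s_1 s_2 s_3 s_2 s_1], and so on. *)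
Fixpoint refl_seq (p : seq S) : seq W :=
  if p is i :: p' then s i :: [seq s i * t * s i | t <- refl_seq p'] else [::].

Lemma size_refl_seq p : size (refl_seq p) = size p.
Proof. by elim: p => //= i p IHp; rewrite size_map IHp. Qed.

Lemma cprod_rcons p i : cprod (rcons p i) = cprod p * s i.
Proof. by rewrite -cats1 big_cat big_seq1. Qed.

Lemma conj_gen_inj i : injective (fun t => s i * t * s i).
Proof. by move=> t t' /mulIg /mulgI. Qed.

Lemma mem_refl_cons i p t :
  (t \in refl_seq (i :: p)) = (t == s i) || (s i * t * s i \in refl_seq p).
Proof.
rewrite inE; congr (_ || _).
rewrite -[RHS](mem_map (@conj_gen_inj i)) !mulgA cox_genK mul1g.
by rewrite cox_genKr.
Qed.

Lemma refl_seq_rcons p i :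
  refl_seq (rcons p i) = rcons (refl_seq p) (cprod p * s i * (cprod p)^-1).
Proof.
elim: p => [|j p IHp] /=; first by rewrite big_nil invg1 mulg1 mul1g.
by rewrite IHp map_rcons big_cons invgM cox_genV !mulgA.
Qed.

Lemma refl_seq_alt k i j :
  refl_seq (alt_seq k i j) = [seq (s i * s j) ^+ h * s i | h <- iota 0 k].
Proof.
elim: k i j => [//|k IHk] i j; rewrite /= IHk mul1g; congr (_ :: _).
rewrite (iotaDl 1) -!map_comp; apply: eq_map => h /=.
by rewrite -expgMC !mulgA.
Qed.

Lemma uniq_refl_alt k i j :
  i <> j -> (k <= m i j)%N -> uniq (refl_seq (alt_seq k i j)).
Proof.
move=> ij km; rewrite refl_seq_alt map_inj_in_uniq ?iota_uniq //.
move=> a b; rewrite !mem_iota /= !add0n => ak bk /mulIg.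
wlog ab : a b ak bk / (a <= b)%N.
  by move=> IH E; case/orP: (leq_total a b) => le; [|apply/esym]; apply: IH.
rewrite -{1}(subnKC ab) expgnDr -[X in X = _ -> _]mulg1 => /mulgI /esym E.
have bk' : (b - a < m i j)%N.
  exact: leq_ltn_trans (leq_subr _ _) (leq_trans bk km).
by apply/eqP; rewrite eqn_leq ab -subn_eq0 (cox_rotation_faithful ij bk' E).
Qed.

(** The two galleries around the dihedral polygon cross the same walls in
opposite orders.  This is why crossing parities are compatible with the braid
relation. *)
Lemma refl_alt_rev i j :
  refl_seq (alt_seq (m i j) j i) = rev (refl_seq (alt_seq (m i j) i j)).
Proof.
rewrite !refl_seq_alt -map_rev; apply: (@eq_from_nth _ 1).
  by rewrite !size_map size_rev.
rewrite size_map size_iota => h hm.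
rewrite !(nth_map 0%N) ?size_rev ?size_iota // nth_rev ?size_iota //.
rewrite !nth_iota ?size_iota // ?add0n; last first.
  by rewrite ltn_subrL (leq_ltn_trans _ hm).
have EV : s j * s i = (s i * s j)^-1 by rewrite invgM !cox_genV.
have key : (s j * s i) ^+ h.+1 = (s i * s j) ^+ (m i j - h.+1).
  apply: (mulgI ((s i * s j) ^+ h.+1)).
  by rewrite EV expVgn mulgV -expgnDr subnKC // cox_rotation_order.
by apply: (mulIg (s i)); rewrite cox_genKr -mulgA -expgSr key.
Qed.

(** The action of a generator on half-spaces: [t] ranges over all of [W] rather
than over reflections only, and the boolean is the side of the wall. *)
Definition refl_flip_fun (i : S) (x : W * bool) : W * bool :=
  (s i * x.1 * s i, x.2 (+) (x.1 == s i)).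

Lemma refl_flip_funK i : involutive (refl_flip_fun i).
Proof.
case=> t b; rewrite /refl_flip_fun /= !mulgA cox_genK mul1g cox_genKr.
have -> : (s i * t * s i == s i) = (t == s i).
  rewrite -(inj_eq (@conj_gen_inj i)) /= cox_genK mul1g.
  by rewrite !mulgA cox_genK mul1g cox_genKr.
by rewrite addbK.
Qed.

Definition refl_flip i : sym (W * bool) :=
  Sym (Bijective (refl_flip_funK i) (refl_flip_funK i)).

Lemma refl_flipK i : refl_flip i * refl_flip i = 1.
Proof. by apply: sym_eq => x /=; rewrite refl_flip_funK. Qed.

(** The inverse is taken so that the letters act in the order in which the
gallery reads them. *)
Lemma refl_flip_prod p t b :
  (\prod_(i <- p) refl_flip i)^-1 (t, b) =
    ((cprod p)^-1 * t * cprod p, b (+) odd (count_mem t (refl_seq p))).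
Proof.
elim: p t b => [|i p IHp] t b.
  by rewrite !big_nil !invg1 mul1g mulg1 addbF.
rewrite !big_cons invgM symM.
have -> : (refl_flip i)^-1 = refl_flip i by apply/mulg1_eq/refl_flipK.
rewrite [refl_flip i _]/= /refl_flip_fun /= IHp invgM cox_genV !mulgA.
congr (_, _); rewrite -addbA; congr (_ (+) _).
rewrite oddD oddb eq_sym count_map; congr (_ (+) odd _).
apply: eq_count => r /=; rewrite -[in RHS](inj_eq (@conj_gen_inj i)).
by rewrite !mulgA cox_genK mul1g cox_genKr.
Qed.

Lemma refl_flip_alt i j :
  alt_prod (m i j) (refl_flip i) (refl_flip j) =
  alt_prod (m i j) (refl_flip j) (refl_flip i).
Proof.
rewrite -!prod_alt_seq; apply: invg_inj; apply: sym_eq => -[t b].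
rewrite !refl_flip_prod refl_alt_rev count_rev !prod_alt_seq.
by rewrite cox_braid.
Qed.

Let flipP := coxeter_sound refl_flipK refl_flip_alt.
Local Notation flip := (pres_lift (rels := coxeter_rel m) refl_flip).

(** Parity of the number of crossings of [t] on the way from 1 to [w]; for a
reflection [t] it says that [t] separates 1 from [w].  In particular
[inversion w (s i)] says that [i] is a left descent of [w], and
[inversion w^-1 (s i)] that it is a right descent. *)
Definition inversion (w t : W) : bool := ((flip w)^-1 (t, false)).2.

Lemma inversion_prod p t :
  inversion (cprod p) t = odd (count_mem t (refl_seq p)).
Proof. by rewrite /inversion (pres_lift_prod flipP) refl_flip_prod. Qed.

Lemma refl_seq_cat p q :
  refl_seq (p ++ q) =
    refl_seq p ++ [seq cprod p * t * (cprod p)^-1 | t <- refl_seq q].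
Proof.
elim: p => [|i p IHp] /=.
  rewrite big_nil; elim: (refl_seq q) => //= t r <-.
  by rewrite mul1g invg1 mulg1.
rewrite IHp map_cat -map_comp; congr (_ :: _ ++ _).
by apply: eq_map => t /=; rewrite big_cons invgM cox_genV !mulgA.
Qed.

Lemma inversionM v w t :
  inversion (v * w) t = inversion v t (+) inversion w (v^-1 * t * v).
Proof.
have [p ->] := cox_prod_surj v; have [q ->] := cox_prod_surj w.
rewrite -big_cat !inversion_prod refl_seq_cat count_cat oddD count_map.
congr (_ (+) odd _); apply: eq_count => r /=.
by apply/eqP/eqP => [<-|->]; rewrite !mulgA ?mulVg ?mulgV mul1g ?mulgK ?mulgVK.
Qed.

Lemma inversion1 t : inversion 1 t = false.
Proof. by have := inversion_prod [::] t; rewrite big_nil. Qed.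

Lemma inversion_gen i t : inversion (s i) t = (t == s i).
Proof.
by have := inversion_prod [:: i] t; rewrite big_seq1 /= addn0 oddb eq_sym.
Qed.

Lemma inversionV w t : inversion w^-1 t = inversion w (w * t * w^-1).
Proof.
have := inversion1 (w * t * w^-1); rewrite -(mulgV w) inversionM.
by rewrite !mulgA mulVg mul1g mulgVK; do 2!case: inversion.
Qed.

Lemma inversion_genM i w t :
  inversion (s i * w) t = (t == s i) (+) inversion w (s i * t * s i).
Proof. by rewrite inversionM inversion_gen cox_genV. Qed.

(** The exchange condition: an odd number of crossings is at least one, and
multiplication by [t] deletes the letter of such a crossing. *)
Lemma inversion_exchange p t :
    inversion (cprod p) t ->
  exists2 q, (size q < size p)%N & t * cprod p = cprod q.
Proof.
elim: p t => [|i p IHp] t; first by rewrite inversion_prod.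
rewrite big_cons inversion_genM.
case: eqP => [-> _|_ /IHp [q qp E]]; first by exists p => //; rewrite cox_genKl.
exists (i :: q) => //; rewrite big_cons -E.
by rewrite !mulgA cox_genK mul1g.
Qed.

End ReflectionCocycle.
(** * The Hecke representation *)

Section HeckeRepresentation.
Variables (S : choiceType) (m : coxeter_matrix S).

Local Notation W := (coxeter_group m).
Local Notation s := (cox_gen m).
Local Notation cprod p := (\prod_(i <- p) s i).

Lemma inversion_gen_mul i w : inversion (s i * w) (s i) = ~~ inversion w (s i).
Proof. by rewrite inversion_genM eqxx cox_genK mul1g. Qed.

(** Left multiplication by [T_i] in the Hecke algebra with [T_i ^ 2 = T_i + 1],
written on coordinates in the standard basis.  The parameter is chosen so that
[T_i] is invertible and all structure constants are non-negative integers. *)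
Definition hecke_fun (i : S) (F : W -> Z) : W -> Z := fun w =>
  Z.add (F (s i * w)) (if inversion w (s i) then F w else Z0).

(** [T_i - 1], the inverse of [T_i]. *)
Definition hecke_inv_fun (i : S) (F : W -> Z) : W -> Z := fun w =>
  Z.add (F (s i * w)) (if inversion w (s i) then Z0 else Z.opp (F w)).

Lemma hecke_funK i : cancel (hecke_fun i) (hecke_inv_fun i).
Proof.
move=> F; apply/funext => w; rewrite /hecke_inv_fun /hecke_fun.
by rewrite cox_genKl inversion_gen_mul; case: inversion => /=; lia.
Qed.

Lemma hecke_inv_funK i : cancel (hecke_inv_fun i) (hecke_fun i).
Proof.
move=> F; apply/funext => w; rewrite /hecke_inv_fun /hecke_fun.
by rewrite cox_genKl inversion_gen_mul; case: inversion => /=; lia.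
Qed.

Definition hecke i : sym (W -> Z) :=
  Sym (Bijective (hecke_funK i) (hecke_inv_funK i)).

(** Right multiplication by [T_j]. *)
Definition hecke_right (j : S) (F : W -> Z) : W -> Z := fun w =>
  Z.add (F (w * s j)) (if inversion w^-1 (s j) then F w else Z0).

(** Associativity of the Hecke algebra.  Multiplying [w] by [s j] on the right
changes whether [i] is a left descent only if [s i * w = w * s j], and
symmetrically; in that case [i] is a left descent of [w] exactly when [j] is a
right descent, and the extra terms cancel. *)
Lemma hecke_right_comm i j F :
  hecke i (hecke_right j F) = hecke_right j (hecke i F).
Proof.
apply/funext => w; rewrite /= /hecke_right /hecke_fun !mulgA.
have EL : inversion (w * s j) (s i) =
    inversion w (s i) (+) (s i * w == w * s j).
  rewrite inversionM inversion_gen; congr (_ (+) _).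
  by rewrite -(inj_eq (mulgI w)) !mulgA mulgV mul1g.
have ER : inversion (s i * w)^-1 (s j) =
    inversion w^-1 (s j) (+) (s i * w == w * s j).
  rewrite invgM cox_genV inversionM inversion_gen invgK; congr (_ (+) _).
  by rewrite -(inj_eq (mulIg w)) mulgVK eq_sym.
rewrite EL ER; have [E|_] := eqVneq (s i * w) (w * s j).
  have -> : inversion w^-1 (s j) = inversion w (s i).
    by rewrite inversionV -E mulgK.
  rewrite E; move: (F _) (F _) (F _) => a b c.
  by case: (inversion w _) => /=; lia.
rewrite !addbF; move: (F _) (F _) (F _) (F _) => a b c d.
by case: (inversion w _); case: (inversion w^-1 _); lia.
Qed.

Lemma hecke_prod_right_comm p j F :
  (\prod_(i <- p) hecke i) (hecke_right j F) =
  hecke_right j ((\prod_(i <- p) hecke i) F).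
Proof.
elim: p => [|i p IHp]; first by rewrite big_nil.
by rewrite big_cons !symM IHp hecke_right_comm.
Qed.

(** Along a gallery that crosses no wall twice, no descent occurs, so only the
leading term survives at the identity. *)
Lemma hecke_prod_reduced p F :
  uniq (refl_seq m p) -> (\prod_(i <- p) hecke i) F 1 = F (cprod p)^-1.
Proof.
elim/last_ind: p F => [|p i IHp] F; first by rewrite !big_nil invg1.
rewrite refl_seq_rcons rcons_uniq cprod_rcons => /andP[Np up].
rewrite -cats1 big_cat big_seq1 symM IHp //= /hecke_fun.
rewrite invgM cox_genV inversionV inversion_prod.
by rewrite (count_memPn Np) /= Z.add_0_r.
Qed.

(** Left operators commute with right operators, and right operators transport
the identity to every element of [W]; hence the braid relation need only be
checked at the identity, where both sides are reduced words of the same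
element. *)
Lemma hecke_alt i j :
  alt_prod (m i j) (hecke i) (hecke j) = alt_prod (m i j) (hecke j) (hecke i).
Proof.
have [->//|/eqP ij] := eqVneq i j.
rewrite -!prod_alt_seq; apply: sym_eq => F; apply/funext => w.
have [p ->] := cox_prod_surj w.
elim/last_ind: p F => [|p l IHp] F.
  have uij := uniq_refl_alt ij (leqnn _).
  have uji : uniq (refl_seq m (alt_seq (m i j) j i)).
    by rewrite refl_alt_rev rev_uniq.
  by rewrite big_nil !hecke_prod_reduced // !prod_alt_seq cox_braid.
rewrite cprod_rcons; have := IHp (hecke_right l F).
rewrite !hecke_prod_right_comm /hecke_right IHp.
by move/Z.add_cancel_r.
Qed.

Lemma hecke_sound u v :
  artin_rel m u v -> word_eval hecke u = word_eval hecke v.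
Proof. by case=> i j; rewrite !word_eval_alt hecke_alt. Qed.

Lemma artin_hecke p q :
    \prod_(i <- p) artin_gen m i = \prod_(i <- q) artin_gen m i ->
  \prod_(i <- p) hecke i = \prod_(i <- q) hecke i.
Proof.
by move/(congr1 (pres_lift hecke)); rewrite !(pres_lift_prod hecke_sound).
Qed.

Definition dirac1 (w : W) : Z := if w == 1 then 1%Z else 0%Z.

(** Coordinates of [T_p], the product of the [T_i] over the letters of [p], in the
standard basis. *)
Definition hecke_coef (p : seq S) : W -> Z := (\prod_(i <- p) hecke i) dirac1.

Lemma hecke_coef_cons i p w :
  hecke_coef (i :: p) w =
    Z.add (hecke_coef p (s i * w))
          (if inversion w (s i) then hecke_coef p w else Z0).
Proof. by rewrite /hecke_coef big_cons symM. Qed.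

Lemma hecke_coef_ge0 p w : Z.le 0 (hecke_coef p w).
Proof.
elim: p w => [|i p IHp] w.
  by rewrite /hecke_coef big_nil /= /dirac1; case: eqP.
rewrite hecke_coef_cons; have := IHp w; have := IHp (s i * w).
by case: inversion; lia.
Qed.

Definition hecke_supp (p : seq S) (w : W) : Prop := Z.lt 0 (hecke_coef p w).

Lemma hecke_supp_cons i p w :
  hecke_supp (i :: p) w <->
  hecke_supp p (s i * w) \/ (inversion w (s i) /\ hecke_supp p w).
Proof.
rewrite /hecke_supp hecke_coef_cons.
have := @hecke_coef_ge0 p w; have := @hecke_coef_ge0 p (s i * w).
move: (hecke_coef _ _) (hecke_coef _ _) => b a.
case: inversion => a0 b0; split.
- by case: (Z.lt_ge_cases 0 a) => ?; [left | right; split => //; lia].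
- by case=> [|[_]]; lia.
- by left; lia.
- by case=> [|[]//]; lia.
Qed.

Lemma hecke_supp_exists p : exists w, hecke_supp p w.
Proof.
elim: p => [|i p [w pw]].
  by exists 1; rewrite /hecke_supp /hecke_coef big_nil /= /dirac1 eqxx.
by exists (s i * w); apply/hecke_supp_cons; left; rewrite cox_genKl.
Qed.

(** A support element without a left descent at [i] can only arise as [s i * w']
with [w'] in the support of [T_p]; since [w'] has the descent, [T_i] keeps it as
well, and non-negative coefficients cannot cancel. *)
Lemma hecke_supp_climb i p w :
    hecke_supp (i :: p) w -> ~~ inversion w (s i) ->
  hecke_supp (i :: p) (s i * w).
Proof.
move=> /hecke_supp_cons [pw|[->//]] Ni.
by apply/hecke_supp_cons; right; rewrite inversion_gen_mul.
Qed.

Lemma hecke_supp_subseq p w :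
  hecke_supp p w -> exists2 q, subseq q p & w = cprod q.
Proof.
elim: p w => [|i p IHp] w.
  rewrite /hecke_supp /hecke_coef big_nil /= /dirac1; case: eqP => // ->.
  by exists [::]; rewrite ?big_nil.
case/hecke_supp_cons => [/IHp [q qp E]|[_ /IHp [q qp ->]]].
  exists (i :: q); first by rewrite /= eqxx.
  by rewrite big_cons -E cox_genKl.
by exists q => //; apply: subseq_trans qp (subseq_cons _ _).
Qed.

End HeckeRepresentation.
(** * Dihedral subgroups and the shortest relation between two generators *)

Section DihedralReflections.
Variables (S : choiceType) (m : coxeter_matrix S).

Local Notation W := (coxeter_group m).
Local Notation s := (cox_gen m).
Local Notation cprod p := (\prod_(i <- p) s i).

(** The reflections of the dihedral subgroup generated by [s i] and [s j]. *)
Definition dihedral_refl (i j : S) : seq W := refl_seq m (alt_seq (m i j) i j).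

Lemma dihedral_reflP i j t :
  reflect (exists h, t = (s i * s j) ^+ h * s i) (t \in dihedral_refl i j).
Proof.
rewrite /dihedral_refl refl_seq_alt.
apply: (iffP mapP) => [[h _ ->]|[h ->]]; first by exists h.
exists (h %% m i j)%N; first by rewrite mem_iota ltn_mod cox_gt0.
rewrite {1}(divn_eq h (m i j)) expgnDr mulnC expgnA.
by rewrite cox_rotation_order expg1n mul1g.
Qed.

Lemma dihedral_refl_sym i j : dihedral_refl j i =i dihedral_refl i j.
Proof.
by move=> t; rewrite /dihedral_refl cox_sym refl_alt_rev mem_rev.
Qed.

Lemma dihedral_refl_conjl i j t :
  t \in dihedral_refl i j -> s i * t * s i \in dihedral_refl i j.
Proof.
case/dihedral_reflP => h ->; apply/dihedral_reflP; exists (h * (m i j).-1)%N.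
set c := s i * s j; have Ec : c * s i * c = s i.
  by rewrite /c !mulgA cox_genKr -(mulgA (s i)) cox_genK mulg1.
have Ech : c ^+ h * s i * c ^+ h = s i.
  elim: h => [|h IHh]; first by rewrite mul1g mulg1.
  rewrite {1}expgSr expgS -[RHS]IHh.
  have -> : c ^+ h * c * s i * (c * c ^+ h) = c ^+ h * (c * s i * c) * c ^+ h.
    by rewrite !mulgA.
  by rewrite Ec.
rewrite mulgA cox_genKr; apply: (mulgI (c ^+ h)).
rewrite !mulgA Ech -expgnDr -mulnS prednK ?cox_gt0 // mulnC expgnA.
by rewrite cox_rotation_order expg1n mul1g.
Qed.

Lemma dihedral_refl_conj i j l t :
    l \in [:: i; j] ->
  t \in dihedral_refl i j -> s l * t * s l \in dihedral_refl i j.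
Proof.
rewrite !inE => /orP[]/eqP->; first exact: dihedral_refl_conjl.
by rewrite -!(dihedral_refl_sym i j); apply: dihedral_refl_conjl.
Qed.

Lemma dihedral_refl_conj_prod i j p t :
    {subset p <= [:: i; j]} ->
  t \in dihedral_refl i j -> (cprod p)^-1 * t * cprod p \in dihedral_refl i j.
Proof.
elim: p t => [|l p IHp] t pij tT; first by rewrite big_nil invg1 mul1g mulg1.
have -> : (cprod (l :: p))^-1 * t * cprod (l :: p) =
    (cprod p)^-1 * (s l * t * s l) * cprod p.
  by rewrite big_cons invgM cox_genV !mulgA.
apply: IHp => [x xp|]; first by apply: pij; rewrite inE xp orbT.
by apply: dihedral_refl_conj => //; apply: pij; rewrite mem_head.
Qed.

Lemma dihedral_refl_word i j t :
  t \in dihedral_refl i j -> exists2 p, {subset p <= [:: i; j]} & t = cprod p.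
Proof.
case/dihedral_reflP => h ->; elim: h => [|h [p pij E]].
  by exists [:: i]; [move=> x; rewrite !inE => ->|rewrite big_seq1 mul1g].
exists [:: i, j & p]; last by rewrite 2!big_cons -E expgS !mulgA.
by move=> x; rewrite !inE => /or3P[->//|->|/pij]; rewrite ?orbT // !inE.
Qed.

Lemma dihedral_refl_gen i j l : s l \in dihedral_refl i j -> l \in [:: i; j].
Proof.
case/dihedral_refl_word => p pij E; apply: pij.
by apply/negPn/negP => lp; apply: (cox_gen_notin lp (esym E)).
Qed.

Lemma cprod_rev p : cprod (rev p) = (cprod p)^-1.
Proof.
elim: p => [|i p IHp]; first by rewrite big_nil invg1.
by rewrite rev_cons cprod_rcons IHp big_cons invgM cox_genV.
Qed.

(** A shortest element [z] of the coset of [w] is separated from 1 by no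
dihedral reflection [t], since by the exchange condition [t * z] would be
shorter. *)
Lemma dihedral_coset_min i j (w : W) :
  exists p z, [/\ {subset p <= [:: i; j]}, w = cprod p * z &
    {in dihedral_refl i j, forall t, ~~ inversion z t}].
Proof.
have [q ->] := cox_prod_surj w.
have [n] := ubnP (size q); elim: n q => // n IHn q qn.
have [/hasP[t tT qt]|/hasPn Nq] :=
  boolP (has (inversion (cprod q)) (dihedral_refl i j)); last first.
  by exists [::], (cprod q); split=> //; rewrite big_nil mul1g.
have [q' q'q E] := inversion_exchange qt.
have [p [z [pij Ez Nz]]] := IHn q' (leq_trans q'q qn).
have [r rij Et] := dihedral_refl_word tT.
exists (rev r ++ p), z; split=> //.
  by move=> x; rewrite mem_cat mem_rev => /orP[/rij|/pij].
by rewrite big_cat cprod_rev -mulgA -Ez -E Et mulKg.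
Qed.

(** Prepending a letter either lengthens an alternating word or cancels its first
letter; at length [m i j] the braid relation always allows the second. *)
Lemma dihedral_normal_form_cons i j (w : W) r :
    (r <= m i j)%N -> w = alt_prod r (s i) (s j) \/ w = alt_prod r (s j) (s i) ->
  exists2 r', (r' <= m i j)%N &
    s i * w = alt_prod r' (s i) (s j) \/ s i * w = alt_prod r' (s j) (s i).
Proof.
have down r0 : (r0 <= m i j)%N -> exists2 r', (r' <= m i j)%N &
    s i * alt_prod r0 (s i) (s j) = alt_prod r' (s i) (s j) \/
    s i * alt_prod r0 (s i) (s j) = alt_prod r' (s j) (s i).
  case: r0 => [_|r0 r0m]; first by exists 1%N; [apply: cox_gt0 | left].
  by exists r0; [apply: ltnW | right; rewrite /= cox_genKl].
move=> rm [->|->]; first exact: down.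
move: rm; rewrite leq_eqVlt => /orP[/eqP->|rm]; last by exists r.+1 => //; left.
by rewrite -cox_braid; apply: down.
Qed.

Lemma dihedral_normal_form i j p :
    {subset p <= [:: i; j]} ->
  exists2 r, (r <= m i j)%N &
    cprod p = alt_prod r (s i) (s j) \/ cprod p = alt_prod r (s j) (s i).
Proof.
elim: p => [|l p IHp] pij; first by exists 0%N => //; left; rewrite big_nil.
have [x xp|r rm E] := IHp; first by apply: pij; rewrite inE xp orbT.
have : l \in [:: i; j] by apply: pij; rewrite mem_head.
rewrite big_cons !inE => /orP[]/eqP->; first exact: dihedral_normal_form_cons E.
rewrite (cox_sym m) in rm; move/or_comm in E.
have [r' r'm E'] := dihedral_normal_form_cons rm E.
by exists r'; [rewrite cox_sym | case: E'; [right|left]].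
Qed.

(** Below the top of a dihedral coset, the next letter is not a descent: [s j] is
crossed neither by [z] nor, by [uniq_refl_alt], by the alternating word. *)
Lemma alt_ascent i j r z :
    i <> j -> (r < m i j)%N ->
    {in dihedral_refl i j, forall t, ~~ inversion z t} ->
  ~~ inversion (alt_prod r (s i) (s j) * z) (s j).
Proof.
move=> ij rm Nz; rewrite inversionM -!(prod_alt_seq s) inversion_prod.
set x := cprod _; have /negPf -> : ~~ inversion z (x^-1 * s j * x).
  apply: Nz; apply: dihedral_refl_conj_prod; first exact: mem_alt_seq.
  rewrite -dihedral_refl_sym; apply/dihedral_reflP; exists 0%N.
  by rewrite mul1g.
rewrite addbF (count_memPn _) //.
have : uniq (refl_seq m (alt_seq r.+1 j i)).
  by apply: uniq_refl_alt; [exact/nesym | rewrite cox_sym].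
rewrite /= => /andP[+ _]; apply: contra => H; apply/mapP; exists (s j) => //.
by rewrite cox_genK mul1g.
Qed.

(** A set that is stable under going up by [s i] and by [s j] contains the top of
each dihedral coset it meets. *)
Lemma alt_climb (X : W -> Prop) z d i j r :
    i <> j -> (r + d)%N = m i j ->
    {in dihedral_refl i j, forall t, ~~ inversion z t} ->
    (forall w, X w -> ~~ inversion w (s i) -> X (s i * w)) ->
    (forall w, X w -> ~~ inversion w (s j) -> X (s j * w)) ->
  X (alt_prod r (s i) (s j) * z) -> X (alt_prod (m i j) (s i) (s j) * z).
Proof.
elim: d i j r => [|d IHd] i j r ij rd Nz Xi Xj Xr; first by rewrite -rd addn0.
rewrite cox_braid (cox_sym m i j); apply: (IHd j i r.+1) => //.
- exact/nesym.
- by rewrite addSnnS rd cox_sym.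
- by move=> t; rewrite dihedral_refl_sym; apply: Nz.
rewrite /= -mulgA; apply: Xj => //; apply: alt_ascent => //.
by rewrite -rd addnS ltnS leq_addr.
Qed.

(** A gallery that stays within the dihedral walls uses the letters [i] and [j]
only, and a repeated letter would cross the same wall twice in a row. *)
Lemma alt_seq_of_refl i j p :
    uniq (refl_seq m (i :: p)) ->
    {subset refl_seq m (i :: p) <= dihedral_refl i j} ->
  i :: p = alt_seq (size p).+1 i j.
Proof.
elim: p i j => [//|l p IHp] i j up pT.
have pT' : {subset refl_seq m (l :: p) <= dihedral_refl i j}.
  move=> t tp.
  have := dihedral_refl_conj (mem_head i [:: j]) (pT (s i * t * s i) _).
  rewrite !mulgA cox_genK mul1g cox_genKr; apply.
  by rewrite mem_refl_cons !mulgA cox_genK mul1g cox_genKr tp orbT.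
have Elj : l = j.
  have : s l \in dihedral_refl i j by apply: pT'; rewrite mem_head.
  move/dihedral_refl_gen; rewrite !inE => /orP[]/eqP // Eli.
  by move: up; rewrite Eli /= inE cox_genK mul1g eqxx.
rewrite -{}Elj in pT pT' *; rewrite [LHS](congr1 (cons i) (IHp l i _ _)) //.
  move: up; rewrite -[refl_seq m (i :: _)]/
    (s i :: [seq s i * t * s i | t <- refl_seq m (l :: p)]).
  by rewrite cons_uniq => /andP[_]; rewrite map_inj_uniq //; apply: conj_gen_inj.
by move=> t /pT'; rewrite dihedral_refl_sym.
Qed.

(** Both words have the same support, which therefore goes up under [s i] and
under [s j] and contains the top of a dihedral coset.  A subword of [i :: p]
reaches that top and must cross all [m i j] dihedral walls; having at most
[m i j] letters, it is [i :: p] itself and crosses nothing else. *)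
Lemma shortest_relation i j p q :
    i <> j -> (size p < m i j)%N ->
    \prod_(x <- i :: p) artin_gen m x = \prod_(x <- j :: q) artin_gen m x ->
  (size p).+1 = m i j /\ i :: p = alt_seq (m i j) i j.
Proof.
move=> ij pm /artin_hecke E.
have Ec : hecke_coef (m := m) (i :: p) = hecke_coef (j :: q).
  by rewrite /hecke_coef E.
pose X := hecke_supp (m := m) (i :: p).
have Xi w : X w -> ~~ inversion w (s i) -> X (s i * w).
  exact: hecke_supp_climb.
have Xj w : X w -> ~~ inversion w (s j) -> X (s j * w).
  by rewrite /X /hecke_supp Ec; apply: hecke_supp_climb.
have [w Xw] := hecke_supp_exists m (i :: p).
have [a [z [aij Ew Nz]]] := dihedral_coset_min i j w.
(* The top of the dihedral coset of [w] lies in the common support. *)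
have {Xw} Xtop : X (alt_prod (m i j) (s i) (s j) * z).
  have [r rm Er] := dihedral_normal_form aij; have Em := subnKC rm.
  move: Xw; rewrite -/(X w) Ew; case: Er => ->.
    exact: (@alt_climb X z (m i j - r) i j r).
  rewrite cox_braid (cox_sym m i j).
  apply: (@alt_climb X z (m i j - r) j i r) => //; first exact/nesym.
    by rewrite Em cox_sym.
  by move=> t; rewrite dihedral_refl_sym; apply: Nz.
have [b bp Eb] := hecke_supp_subseq Xtop.
have uT : uniq (dihedral_refl i j) by apply: uniq_refl_alt.
have sT : size (dihedral_refl i j) = m i j by rewrite size_refl_seq size_alt_seq.
(* [z] contributes no dihedral inversion and the longest dihedral element
   contributes each of them once. *)
have Tb : {subset dihedral_refl i j <= refl_seq m b}.
  move=> t tT; rewrite -has_pred1 has_count; apply: odd_gt0.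
  rewrite -inversion_prod -Eb -(prod_alt_seq s) inversionM inversion_prod.
  rewrite (count_uniq_mem _ uT) tT (negPf (Nz _ _)) //.
  by apply: dihedral_refl_conj_prod => //; apply: mem_alt_seq.
have mb : (m i j <= size b)%N.
  by rewrite -sT -(size_refl_seq m); apply: uniq_leq_size.
have Ebp : b = i :: p.
  apply/eqP; rewrite -(size_subseq_leqif bp).2 eqn_leq size_subseq //=.
  exact: leq_trans pm mb.
have Esz : (size p).+1 = m i j.
  by apply/eqP; rewrite eqn_leq pm -[(size p).+1]/(size (i :: p)) -Ebp.
split=> //; rewrite -Esz.
have szb : (size (refl_seq m b) <= size (dihedral_refl i j))%N.
  by rewrite size_refl_seq sT Ebp -Esz.
have [_ Tb'] := uniq_min_size uT Tb szb.
apply: alt_seq_of_refl; rewrite -Ebp; first exact: leq_size_uniq uT Tb szb.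
by move=> t; rewrite Tb'.
Qed.

End DihedralReflections.
Local Open Scope classical_set_scope.
Local Open Scope group_scope.
(** * Automorphisms of the ordered Artin-Tits group *)

Section OrderAutomorphisms.
Variables (S : choiceType) (m : coxeter_matrix S).

Local Notation A := (artin_group m).
Local Notation a := (artin_gen m).
Local Notation aprod p := (\prod_(i <- p) a i).

Lemma artin_leP (g h : A) : artin_le g h <-> exists p, h = g * aprod p.
Proof.
split=> [[p E]|[p ->]]; exists p; last by rewrite mulKg.
by rewrite -[aprod p]/(\prod_(i <- p) artin_gen m i) -E mulVKg.
Qed.

(** Letting every generator act on [Z] by one and the same translation turns the
length of positive words into an invariant of the group element. *)
Definition succ_sym : sym Z := Sym (Bijective Z.pred_succ Z.succ_pred).

Lemma artin_size p q : aprod p = aprod q -> size p = size q.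
Proof.
have sound u v : artin_rel m u v ->
    word_eval (fun=> succ_sym) u = word_eval (fun=> succ_sym) v.
  by case=> i j; rewrite !word_eval_alt.
have sizeE r : (\prod_(i <- r) succ_sym) Z0 = Z.of_nat (size r).
  elim: r => [|i r IHr]; first by rewrite big_nil.
  by rewrite big_cons symM IHr [RHS]Nat2Z.inj_succ.
move/(congr1 (pres_lift (rels := artin_rel m) (fun=> succ_sym))).
rewrite !(pres_lift_prod sound) => /(congr1 (fun f : sym Z => f Z0)).
by rewrite !sizeE => /Nat2Z.inj.
Qed.

Lemma artin_gen_inj : injective a.
Proof.
move=> i j E; apply/eqP/negPn/negP => /eqP ij; have m1 := cox_entry_gt1 m ij.
have [||Em _] := @shortest_relation S m i j [::] [::] ij.
- exact: ltnW.
- by rewrite !big_seq1.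
- by rewrite -Em in m1.
Qed.

Lemma artin_ind (Q : A -> Prop) :
    Q 1 -> (forall g i, Q g -> Q (g * a i)) ->
    (forall g i, Q g -> Q (g * (a i)^-1)) ->
  forall g, Q g.
Proof. exact: pres_ind. Qed.

Lemma order_automorphism_subgroup : is_subgroup (order_automorphisms m).
Proof.
split=> [x y //|f g Hf Hg x y|f Hf x y]; first by rewrite Hg Hf.
by rewrite (Hf (_ x)) !symVK.
Qed.

(** By additivity of the length, nothing lies strictly between [g] and
[g * a i].  If [f g] and [f (g * a i)] were more than one letter apart, the
preimage of an intermediate element would lie there. *)
Lemma order_automorphism_gen f g i :
  order_automorphisms m f -> exists j, f (g * a i) = f g * a j.
Proof.
move=> Hf; have : artin_le (f g) (f (g * a i)).
  by apply: (proj1 (Hf _ _)); apply/artin_leP; exists [:: i]; rewrite big_seq1.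
case/artin_leP => [[|j [|k p]] E]; last 2 first.
- by exists j; rewrite E big_seq1.
- pose h := (f^-1)%g (f g * a j).
  have Eh : f h = f g * a j by rewrite symVK.
  have /artin_leP [q Eq] : artin_le g h.
    apply: (proj2 (Hf _ _)); apply/artin_leP.
    by exists [:: j]; rewrite big_seq1.
  have /artin_leP [r Er] : artin_le h (g * a i).
    apply: (proj2 (Hf _ _)); apply/artin_leP.
    by exists (k :: p); rewrite Eh E big_cons mulgA.
  have : aprod [:: i] = aprod (q ++ r).
    by apply: (mulgI g); rewrite big_seq1 Er Eq big_cat mulgA.
  move/artin_size; rewrite size_cat /= => Esz.
  case: q Eq Esz => [|x q] Eq Esz.
    have : aprod [::] = aprod [:: j].
      by apply: (mulgI (f g)); rewrite big_seq1 -Eh Eq big_nil !mulg1.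
    by move/artin_size.
  case: r Er Esz => [|y r] Er; last by rewrite /= addnS.
  move: Er; rewrite big_nil mulg1 => Er.
  have : aprod [:: j] = aprod [:: j, k & p].
    by apply: (mulgI (f g)); rewrite big_seq1 -Eh -Er E.
  by move/artin_size.
have : aprod [:: i] = aprod [::].
  apply: (mulgI g); apply: (@sym_inj _ f).
  by rewrite big_seq1 E !big_nil !mulg1.
by move/artin_size.
Qed.

(** [phi g] is the permutation that [f] induces on the covers of [g]. *)
Definition follows (f : sym A) (phi : A -> S -> S) :=
  forall g i, f (g * a i) = f g * a (phi g i).

Lemma order_automorphism_follows f :
  order_automorphisms m f -> exists phi, follows f phi.
Proof.
move=> Hf.
have /choice [phi Hphi] :
    forall x : A * S, exists j, f (x.1 * a x.2) = f x.1 * a j.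
  by move=> [g i]; apply: order_automorphism_gen.
by exists (fun g i => phi (g, i)) => g i; apply: (Hphi (g, i)).
Qed.

Section Follows.
Variables (f : sym A) (phi psi : A -> S -> S).
Hypotheses (Hphi : follows f phi) (Hpsi : follows f^-1 psi).

Lemma followsK g : cancel (phi g) (psi (f g)).
Proof.
move=> i; apply: artin_gen_inj; apply: (mulgI g).
by rewrite -{1}(symK f g) -Hpsi -Hphi symK.
Qed.

Lemma followsVK g : cancel (psi (f g)) (phi g).
Proof.
move=> i; apply: artin_gen_inj; apply: (mulgI (f g)).
by rewrite -Hphi -{1}(symK f g) -Hpsi symVK.
Qed.

End Follows.

(** The labels of the image under [f] of the chain that starts at [g] and is
labelled by [p]. *)
Fixpoint trace (phi : A -> S -> S) (g : A) (p : seq S) : seq S :=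
  if p is i :: p' then phi g i :: trace phi (g * a i) p' else [::].

Lemma size_trace phi g p : size (trace phi g p) = size p.
Proof. by elim: p g => //= i p IHp g; rewrite IHp. Qed.

Lemma follows_trace f phi g p :
  follows f phi -> f (g * aprod p) = f g * aprod (trace phi g p).
Proof.
move=> Hphi; elim: p g => [|i p IHp] g; first by rewrite !big_nil !mulg1.
by rewrite /= !big_cons !mulgA IHp Hphi.
Qed.

Lemma artin_braid i j :
  aprod (alt_seq (m i j) i j) = aprod (alt_seq (m i j) j i).
Proof.
rewrite !prod_alt_seq -!word_eval_alt.
by apply/pres_eval_eq/Word_rel.
Qed.

(** The images of the two chains of the braid relation at [g] satisfy the
hypotheses of [shortest_relation] when [m i j] does not exceed the target
entry; [follows_local] gets rid of this proviso by exchanging the roles of [f]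
and its inverse. *)
Lemma follows_braid f phi g i j :
    follows f phi -> i <> j -> phi g i <> phi g j ->
    (m i j <= m (phi g i) (phi g j))%N ->
  m i j = m (phi g i) (phi g j) /\
  trace phi g (alt_seq (m i j) i j) = alt_seq (m i j) (phi g i) (phi g j).
Proof.
move=> Hphi ij ij' le_m.
have : aprod (trace phi g (alt_seq (m i j) i j)) =
       aprod (trace phi g (alt_seq (m i j) j i)).
  by apply: (mulgI (f g)); rewrite -!(follows_trace _ _ Hphi) artin_braid.
case Em: (m i j) le_m (cox_gt0 m i j) => [//|k] le_m _ /=.
move=> /(shortest_relation ij') []; first by rewrite size_trace size_alt_seq.
by rewrite size_trace size_alt_seq => <-.
Qed.

Lemma follows_local f phi psi g i j :
    follows f phi -> follows f^-1 psi -> i <> j ->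
  m (phi g i) (phi g j) = m i j /\ phi (g * a i) j = phi g j.
Proof.
move=> Hphi Hpsi ij; have phiK := followsK Hphi Hpsi g.
have ij' : phi g i <> phi g j by move/(can_inj phiK).
have Em : m i j = m (phi g i) (phi g j).
  have [le_m|/ltnW ge_m] := leqP (m i j) (m (phi g i) (phi g j)).
    by have [] := follows_braid Hphi ij ij' le_m.
  by have [] := follows_braid (g := f g) Hpsi ij'; rewrite !phiK.
split=> //; have := cox_entry_gt1 m ij.
have [] := follows_braid Hphi ij ij'; first by rewrite -Em leqnn.
by case: (m i j) => [|[|k]] //= _ [].
Qed.

(** [phi (g * a l)] and [phi g] agree at every index other than [l]; being
bijective, they agree at [l] as well. *)
Lemma follows_const f phi psi g i :
  follows f phi -> follows f^-1 psi -> phi g i = phi 1 i.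
Proof.
move=> Hphi Hpsi.
have step h l : phi (h * a l) =1 phi h.
  have off x : l <> x -> phi (h * a l) x = phi h x.
    by move=> lx; have [] := follows_local h Hphi Hpsi lx.
  move=> x; have [<-|/eqP] := eqVneq l x; last exact: off.
  have := followsVK Hphi Hpsi (h * a l) (phi h l).
  set y := psi _ _ => Ey.
  have [El|/eqP ly] := eqVneq l y; first by rewrite -Ey -El.
  by case: (ly); apply: (can_inj (followsK Hphi Hpsi h)); rewrite -Ey off.
elim/artin_ind: g => // g l <-; first exact: step.
by rewrite -(step (g * (a l)^-1) l) mulgVK.
Qed.

Lemma order_automorphism_diagram f :
  order_automorphisms m f -> f 1 = 1 -> diagram_automorphisms m f.
Proof.
move=> Hf f1; have [_ _ /(_ _ Hf) Hf'] := order_automorphism_subgroup.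
have [phi Hphi] := order_automorphism_follows Hf.
have [psi Hpsi] := order_automorphism_follows Hf'.
have fM g i : f (g * a i) = f g * a (phi 1 i).
  by rewrite Hphi (follows_const g i Hphi Hpsi).
have fgen i : f (a i) = a (phi 1 i) by rewrite -[a i]mul1g fM f1 mul1g.
have fV g i : f (g * (a i)^-1) = f g * (a (phi 1 i))^-1.
  by apply: (mulIg (a (phi 1 i))); rewrite -fM !mulgVK.
split.
  move=> g h; elim/artin_ind: h g => [|h i IHh|h i IHh] g.
  - by rewrite f1 !mulg1.
  - by rewrite mulgA !fM IHh mulgA.
  - by rewrite mulgA !fV IHh mulgA.
exists (Sym (Bijective (followsK Hphi Hpsi 1) (followsVK Hphi Hpsi 1))).
split=> [i j|i]; last exact: fgen.
have [->|/eqP ij] := eqVneq i j; first by rewrite !(iffRL (cox_eq1 m _ _)).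
by have [] := follows_local 1 Hphi Hpsi ij.
Qed.

Lemma translation_order f :
  left_translations A f -> order_automorphisms m f.
Proof.
case=> g fE x y; rewrite !fE /artin_le invgM mulgA.
by rewrite -(mulgA x^-1) mulVg mulg1.
Qed.

Lemma diagram_order f : diagram_automorphisms m f -> order_automorphisms m f.
Proof.
case=> fM [phi [_ fgen]].
have f1 : f 1 = 1 by apply: (mulgI (f 1)); rewrite -fM !mulg1.
have fprod p : f (aprod p) = aprod [seq phi i | i <- p].
  by elim: p => [|i p IHp]; rewrite ?big_nil //= !big_cons fM fgen IHp.
move=> x y; split=> /artin_leP [p E]; apply/artin_leP.
  by exists [seq phi i | i <- p]; rewrite E fM fprod.
exists [seq (phi^-1)%g i | i <- p]; apply: (@sym_inj _ f).
rewrite E fM fprod -map_comp.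
by rewrite map_id_in // => i _ /=; rewrite symVK.
Qed.

Lemma diagram_subgroup : is_subgroup (diagram_automorphisms m).
Proof.
split.
- by split=> //; exists 1.
- move=> f g [fM [phi [phim fgen]]] [gM [psi [psim ggen]]]; split.
    by move=> x y; rewrite !symM gM fM.
  exists (phi * psi); split=> [i j|i]; first by rewrite !symM phim psim.
  by rewrite !symM ggen fgen.
- move=> f [fM [phi [phim fgen]]]; split.
    by move=> x y; apply: (@sym_inj _ f); rewrite fM !symVK.
  exists (phi^-1)%g; split=> [i j|i]; first by rewrite -phim !symVK.
  by apply: (@sym_inj _ f); rewrite fgen !symVK.
Qed.

Lemma order_automorphism_decomp f :
    order_automorphisms m f ->
  exists t d, [/\ left_translations A t, diagram_automorphisms m d & f = t * d].
Proof.
move=> Hf; pose t : sym A := Sym (Bijective (mulKg (f 1)) (mulVKg (f 1))).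
have Lt : left_translations A t by exists (f 1).
have [_ HM HV] := order_automorphism_subgroup.
exists t, (t^-1 * f); split=> //; last by rewrite mulVKg.
apply: order_automorphism_diagram; first exact/HM/Hf/HV/translation_order.
by apply: (@sym_inj _ t); rewrite symM symVK /= mulg1.
Qed.

End OrderAutomorphisms.

(** * Normalisers and the holomorph *)

Section Subgroups.
Variable G : groupType.

Lemma translation_subgroup : is_subgroup (left_translations G).
Proof.
split.
- by exists 1 => x; rewrite mul1g.
- by move=> f g [x fE] [y gE]; exists (x * y) => z; rewrite symM gE fE mulgA.
- move=> f [x fE]; exists x^-1 => z; apply: (@sym_inj _ f).
  by rewrite symVK fE mulVKg.
Qed.

Lemma normaliserP (N : set G) g :
    (forall x, N x -> N (g * x * g^-1)) ->
    (forall x, N x -> N (g^-1 * x * g)) ->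
  normaliser N g.
Proof.
move=> Ng NgV; apply/seteqP; split=> [_ [x /Ng Nx <-] //|x /NgV Nx].
by exists (g^-1 * x * g) => //; rewrite !mulgA mulgV mul1g mulgK.
Qed.

Lemma normaliserJ (N : set G) g x :
  normaliser N g -> N x -> N (g * x * g^-1) /\ N (g^-1 * x * g).
Proof.
move=> Ng Nx; split; first by rewrite -Ng; exists x.
case: (eq_ind_r (fun B : set G => B x) Nx Ng) => y Ny <-.
by rewrite !mulgA mulVg mul1g mulgVK.
Qed.

Lemma normaliser_subgroup (N : set G) : is_subgroup (normaliser N).
Proof.
split.
- by apply: normaliserP => x; rewrite invg1 mul1g mulg1.
- move=> g h Ng Nh; apply: normaliserP => x Nx.
    have := (normaliserJ Ng (normaliserJ Nh Nx).1).1.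
    by rewrite invgM !mulgA.
  have := (normaliserJ Nh (normaliserJ Ng Nx).2).2.
  by rewrite invgM !mulgA.
- move=> g Ng; apply: normaliserP => x Nx; rewrite ?invgK.
    exact: (normaliserJ Ng Nx).2.
  exact: (normaliserJ Ng Nx).1.
Qed.

End Subgroups.

(** For [f = t * d] with [t] a translation and [d] a group automorphism, the
conjugate by [f] of a left translation is again a left translation; applied to
[f] and to its inverse this gives the normaliser condition. *)
Lemma order_automorphism_holomorph (S : choiceType) (m : coxeter_matrix S) f :
  order_automorphisms m f -> holomorph (artin_group m) f.
Proof.
have conj h t : order_automorphisms m h ->
    left_translations (artin_group m) t ->
  left_translations (artin_group m) (h * t * h^-1).
  move=> /order_automorphism_decomp[u [d [[x tE] [dM _] ->]]] [y uE].
  have uV z : (u^-1)%g z = x^-1 * z.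
    by apply: (@sym_inj _ u); rewrite symVK tE mulVKg.
  by exists (x * d y * x^-1) => z; rewrite invgM !symM tE uE dM symVK uV !mulgA.
have [_ _ HV] := order_automorphism_subgroup m.
move=> Hf; apply: normaliserP => t Lt; first exact: conj.
by have := conj _ _ (HV _ Hf) Lt; rewrite invgK.
Qed.

Theorem theorem3p2 (S : choiceType) (m : coxeter_matrix S) :
  spherical m ->
  internal_sdprod (order_automorphisms m)
    (left_translations (artin_group m)) (diagram_automorphisms m) /\
  (is_subgroup (holomorph (artin_group m)) /\
   order_automorphisms m `<=` holomorph (artin_group m)).
Proof.
move=> _; have HA := order_automorphism_subgroup m.
split; last first.
  by split; [apply: normaliser_subgroup | apply: order_automorphism_holomorph].
split=> //.
- by split; [apply: translation_subgroup | apply: diagram_subgroup].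
- by split; [apply: translation_order | apply: order_automorphism_holomorph].
- apply/seteqP; split=> [f [[g fE] [fM _]]|f ->]; last first.
    by case: (translation_subgroup (artin_group m)) (diagram_subgroup m)
      => L1 _ _ [].
  have f1 : f 1 = 1 by apply: (mulgI (f 1)); rewrite -fM !mulg1.
  by apply: sym_eq => x; rewrite fE -[g]mulg1 -fE f1 mul1g.
- apply/seteqP; split=> [_ [t Lt [d Dd <-]]|f].
    case: HA => _ HM _.
    by apply: HM; [apply: translation_order | apply: diagram_order].
  case/order_automorphism_decomp => t [d [Lt Dd ->]].
  by exists t => //; exists d.
Qed.
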